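(* Let $V^1$, $V^2$, and $V^3$ be finite dimensional real vector spaces. If the sets $\{x^1_1,x^1_2\}\subseteq V^1$, $\{x^2_1,x^2_2\}\subseteq V^2$, and $\{x^3_1,x^3_2\}\subseteq V^3$ are linearly independent, then the tensor $$\beta = x^1_2\otimes x^2_1\otimes x^3_1 + x^1_1\otimes x^2_2\otimes x^3_1 + x^1_1\otimes x^2_1\otimes x^3_2$$ has rank three.
   Context: Superscripts are indices, not powers. The rank of a tensor $\tau\in V^1\otimes V^2\otimes V^3$ is the minimum $n$ such that $\tau = \sum_{i=1}^n v^1_i\otimes v^2_i\otimes v^3_i$ for some $v^s_i\in V^s$. Each set $\{x^i_1,x^i_2\}$ consists of two vectors, and its linear independence means that $x^i_1,x^i_2$ are linearly independent. *)

(* Defs.v *)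
From HB Require Import structures.
From mathcomp Require Import all_boot all_order all_algebra.
From mathcomp Require Import reals.

Set Implicit Arguments.
Unset Strict Implicit.
Unset Printing Implicit Defensive.

Import GRing.Theory.
Local Open Scope ring_scope.

Definition trilinear (K : fieldType) (V1 V2 V3 W : lmodType K)
    (g : V1 -> V2 -> V3 -> W) : Prop :=
  [/\ forall v2 v3, linear (fun v1 => g v1 v2 v3),
      forall v1 v3, linear (fun v2 => g v1 v2 v3) &
      forall v1 v2, linear (fun v3 => g v1 v2 v3)].

(* The pair (T, tens) is a tensor product of V1, V2 and V3, i.e. it has the
   universal property: T plays the role of the space V1 (x) V2 (x) V3, and
   [tens v1 v2 v3] that of the pure tensor v1 (x) v2 (x) v3.  Such a pair is
   unique up to a unique isomorphism; its existence for finite dimensional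
   spaces is [tensor_product3_exists] below. *)
Definition is_tensor_product3 (K : fieldType) (V1 V2 V3 T : lmodType K)
    (tens : V1 -> V2 -> V3 -> T) : Prop :=
  trilinear tens /\
  forall (W : lmodType K) (g : V1 -> V2 -> V3 -> W), trilinear g ->
    exists h : {linear T -> W},
      (forall v1 v2 v3, h (tens v1 v2 v3) = g v1 v2 v3) /\
      (forall h' : {linear T -> W},
         (forall v1 v2 v3, h' (tens v1 v2 v3) = g v1 v2 v3) -> h' =1 h).

Definition sum_of_pure_tensors (K : fieldType) (V1 V2 V3 T : lmodType K)
    (tens : V1 -> V2 -> V3 -> T) (tau : T) (n : nat) : Prop :=
  exists (v1 : 'I_n -> V1) (v2 : 'I_n -> V2) (v3 : 'I_n -> V3),
    tau = \sum_(i < n) tens (v1 i) (v2 i) (v3 i).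

Definition has_tensor_rank (K : fieldType) (V1 V2 V3 T : lmodType K)
    (tens : V1 -> V2 -> V3 -> T) (tau : T) (n : nat) : Prop :=
  sum_of_pure_tensors tens tau n /\
  forall m : nat, sum_of_pure_tensors tens tau m -> (n <= m)%N.

Section Existence.
Variables (K : fieldType) (V1 V2 V3 : vectType K).

Let B1 := vbasis {:V1}.
Let B2 := vbasis {:V2}.
Let B3 := vbasis {:V3}.
Let I := ('I_(\dim {:V1}) * 'I_(\dim {:V2}) * 'I_(\dim {:V3}))%type.

Definition coord_tens (v1 : V1) (v2 : V2) (v3 : V3) : {ffun I -> K^o} :=
  [ffun p : I => (coord B1 p.1.1 v1 * coord B2 p.1.2 v2 * coord B3 p.2 v3 : K)].

Lemma coord_tens_trilinear : trilinear coord_tens.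
Proof.
split=> [v2 v3 a u v|v1 v3 a u v|v1 v2 a u v]; apply/ffunP=> p;
  rewrite !ffunE linearP /=.
- by rewrite !mulrDl -!mulrA.
- by rewrite mulrDr mulrDl -!mulrA mulrCA.
- by rewrite mulrDr mulrCA.
Qed.

Lemma trilinear_expand (W : lmodType K) (g : V1 -> V2 -> V3 -> W) v1 v2 v3 :
  trilinear g -> g v1 v2 v3 =
    \sum_(p : I) coord_tens v1 v2 v3 p *: g B1`_p.1.1 B2`_p.1.2 B3`_p.2.
Proof.
have lsum (U : lmodType K) (f : U -> W) (J : finType) (c : J -> K) (u : J -> U) :
    linear f -> f (\sum_j c j *: u j) = \sum_j c j *: f (u j).
  move=> fL; pose fM := GRing.isLinear.Build K U W *:%R f fL.
  pose fl : {linear U -> W} := HB.pack f fM.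
  by rewrite -[f]/(fl : _ -> _) linear_sum; apply: eq_bigr => j _; rewrite linearZ.
case=> g1 g2 g3.
rewrite {1}(coord_vbasis (memvf v1)) (lsum _ _ _ _ _ (g1 _ _)).
under eq_bigr => i _.
  rewrite {1}(coord_vbasis (memvf v2)) (lsum _ _ _ _ _ (g2 _ _)) scaler_sumr.
  under eq_bigr => j _.
    rewrite {1}(coord_vbasis (memvf v3)) (lsum _ _ _ _ _ (g3 _ _)).
    rewrite scalerA scaler_sumr.
    under eq_bigr do rewrite scalerA.
    over.
  over.
rewrite pair_big /= pair_big /=.
by apply: eq_bigr => p _; rewrite ffunE.
Qed.

Lemma tensor_product3_exists :
  exists (T : lmodType K) (tens : V1 -> V2 -> V3 -> T), is_tensor_product3 tens.
Proof.
exists {ffun I -> K^o}, coord_tens; split; first exact: coord_tens_trilinear.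
move=> W g gL.
pose h (f : {ffun I -> K^o}) : W :=
  \sum_(p : I) f p *: g B1`_p.1.1 B2`_p.1.2 B3`_p.2.
have hL : linear h.
  move=> a u v; rewrite /h scaler_sumr -big_split; apply: eq_bigr => p _ /=.
  by rewrite !ffunE scalerDl scalerA.
pose hM := GRing.isLinear.Build K {ffun I -> K^o} W *:%R h hL.
pose hl : {linear {ffun I -> K^o} -> W} := HB.pack h hM.
exists hl; split=> [v1 v2 v3|h' h'E f]; first by rewrite (trilinear_expand _ _ _ gL).
have fE : f = \sum_(p : I)
    (f p : K) *: coord_tens B1`_p.1.1 B2`_p.1.2 B3`_p.2.
  apply/ffunP=> q; rewrite sum_ffunE (bigD1 q) //= big1 => [|p pq].
    rewrite !ffunE !coord_free ?(basis_free (vbasisP _)) // !eqxx !mulr1 addr0.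
    by rewrite /GRing.scale /= mulr1.
  rewrite !ffunE !coord_free ?(basis_free (vbasisP _)) //.
  case: p q pq => [[i j] k] [[i' j'] k'] /=; rewrite !xpair_eqE.
  by rewrite -!natrM !mulnb => /negbTE->; rewrite /GRing.scale /= mulr0.
rewrite {1}fE linear_sum; apply: eq_bigr => p _.
by rewrite linearZ h'E.
Qed.

End Existence.

(* Main.v *)
(** Coordinate forms dual to the pairs [x^i_1, x^i_2] turn a decomposition of
    beta into two pure tensors into a decomposition of a 2 x 2 x 2 array, whose
    two slices are T_0 = ((0,1),(1,0)) and T_1 = ((1,0),(0,0)).  Such a
    decomposition diagonalises both slices at once, T_u = A diag(c_u) B^T, so
    -s^2 = det (s T_0 + t T_1) = det A det B prod_i (s c_0i + t c_1i).  Hence no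
    c_0i vanishes, every c_1i does, and T_1 = 0, a contradiction. *)
Require Import Defs.
From mathcomp Require Import all_boot all_order all_algebra.
From mathcomp Require Import reals ring.
Import GRing.Theory.
Local Open Scope ring_scope.

(** The right-hand side is the coordinate array of beta: index [1] stands for the second vector of a
    pair, and each term of beta contains exactly one such vector. *)
Lemma no_two_term_decomposition (K : fieldType) (a b c : 'I_2 -> 'I_2 -> K) :
  ~ (forall s t u : 'I_2,
       \sum_(i < 2) a s i * b t i * c u i = (s + t + u == 1)%N%:R).
Proof.
move=> E.
have e s t u : a s 0 * b t 0 * c u 0 + a s 1 * b t 1 * c u 1
    = (s + t + u == 1)%N%:R.
  by rewrite -E big_ord_recl big_ord1; congr (_ + a s _ * b t _ * c u _);
    apply: val_inj.
have e000 := e 0 0 0; have e001 := e 0 0 1; have e010 := e 0 1 0.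
have e011 := e 0 1 1; have e100 := e 1 0 0; have e101 := e 1 0 1.
have e110 := e 1 1 0; have e111 := e 1 1 1.
rewrite /= in e000 e001 e010 e011 e100 e101 e110 e111.
(* [D] is det A det B, and [T s t u] is the entry (s, t) of the slice T_u. [D00], [D01], [D11]
   compare the coefficients of s^2, st and t^2 in the determinant identity. *)
pose D := (a 0 0 * a 1 1 - a 0 1 * a 1 0) * (b 0 0 * b 1 1 - b 0 1 * b 1 0).
pose T s t u := a s 0 * b t 0 * c u 0 + a s 1 * b t 1 * c u 1.
have D00 : D * (c 0 0 * c 0 1) = -1.
  have -> : D * (c 0 0 * c 0 1) = T 0 0 0 * T 1 1 0 - T 0 1 0 * T 1 0 0.
    by rewrite /D /T; ring.
  by rewrite /T e000 e110 e010 e100; ring.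
have D01 : D * (c 0 0 * c 1 1 + c 1 0 * c 0 1) = 0.
  have -> : D * (c 0 0 * c 1 1 + c 1 0 * c 0 1) =
      T 0 0 0 * T 1 1 1 + T 0 0 1 * T 1 1 0
      - T 0 1 0 * T 1 0 1 - T 0 1 1 * T 1 0 0.
    by rewrite /D /T; ring.
  by rewrite /T e000 e111 e001 e110 e010 e101 e011 e100; ring.
have D11 : D * (c 1 0 * c 1 1) = 0.
  have -> : D * (c 1 0 * c 1 1) = T 0 0 1 * T 1 1 1 - T 0 1 1 * T 1 0 1.
    by rewrite /D /T; ring.
  by rewrite /T e001 e111 e011 e101; ring.
(* With its body hidden, [D] counts as a single factor for [mulf_eq0]. *)
clearbody D.
have : D * (c 0 0 * c 0 1) != 0 by rewrite D00 oppr_eq0 oner_eq0.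
rewrite !mulf_eq0 !negb_or => /and3P[/negPf D0 /negPf c00 /negPf c01].
move/eqP: D11 D01; rewrite !mulf_eq0 D0 /=.
move=> c1 /eqP; rewrite mulf_eq0 D0 /=.
(* By [D11] one of [c 1 0], [c 1 1] vanishes; [D01] then kills the other, against the entry 1 in
   [e001]. *)
case/orP: c1 => /eqP c1; rewrite c1.
  rewrite mul0r addr0 mulf_eq0 c00 => /eqP c1'.
  by move/esym/eqP: e001; rewrite c1 c1' !mulr0 addr0 oner_eq0.
rewrite mulr0 add0r mulf_eq0 c01 orbF => /eqP c1'.
by move/esym/eqP: e001; rewrite c1 c1' !mulr0 addr0 oner_eq0.
Qed.

Lemma trilinear_form (K : fieldType) (V1 V2 V3 : lmodType K)
    (f1 : {linear V1 -> K^o}) (f2 : {linear V2 -> K^o})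
    (f3 : {linear V3 -> K^o}) :
  trilinear (fun v1 v2 v3 => (f1 v1 * f2 v2 * f3 v3 : K^o)).
Proof.
by split=> [v2 v3|v1 v3|v1 v2] a u v;
  rewrite linearP /GRing.scale /=; ring.
Qed.

Lemma trilinear0 (K : fieldType) (V1 V2 V3 W : lmodType K)
    (g : V1 -> V2 -> V3 -> W) v2 v3 :
  trilinear g -> g 0 v2 v3 = 0.
Proof.
by case=> /(_ v2 v3 (-1) 0 0) + _ _; rewrite scaler0 addr0 scaleN1r addNr.
Qed.

(** Padding with zero pure tensors reduces every length below three to exactly two. *)
Lemma sum_of_pure_tensors_leq (K : fieldType) (V1 V2 V3 T : lmodType K)
    (tens : V1 -> V2 -> V3 -> T) (tau : T) (m n : nat) :
  trilinear tens -> (m <= n)%N ->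
  sum_of_pure_tensors tens tau m -> sum_of_pure_tensors tens tau n.
Proof.
move=> tensL /subnK<-; elim: (n - m)%N => // k IHk /IHk[v1 [v2 [v3 ->]]].
pose ext (V : lmodType K) (v : 'I_(k + m) -> V) (i : 'I_(k + m).+1) :=
  oapp v 0 (unlift ord0 i).
exists (ext _ v1), (ext _ v2), (ext _ v3).
rewrite big_ord_recl {1}/ext unlift_none trilinear0 // add0r.
by apply: eq_bigr => i _; rewrite /ext liftK.
Qed.

(** The two equations are paired by [*] so that [rewrite] can use them as a multirule. *)
Lemma free_pair_dual (K : fieldType) (V : vectType K) (x y : V) :
  free [:: x; y] ->
  exists f : 'I_2 -> {linear V -> K^o},
    forall i, (f i x = (i == 0%N :> nat)%:R) * (f i y = (i == 1%N :> nat)%:R).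
Proof.
move=> xy_free; exists (fun i => coord [tuple x; y] i) => i; split.
  by have := coord_free 0 i xy_free; rewrite (eq_sym 0 i).
by have := coord_free 1 i xy_free; rewrite (eq_sym 1 i).
Qed.

Theorem theorem3 (R : realType) (V1 V2 V3 : vectType R)
    (T : lmodType R) (tens : V1 -> V2 -> V3 -> T)
    (tensP : is_tensor_product3 tens)
    (x1_1 x1_2 : V1) (x2_1 x2_2 : V2) (x3_1 x3_2 : V3)
    (free1 : free [:: x1_1; x1_2])
    (free2 : free [:: x2_1; x2_2])
    (free3 : free [:: x3_1; x3_2]) :
  has_tensor_rank tens
    (tens x1_2 x2_1 x3_1 + tens x1_1 x2_2 x3_1 + tens x1_1 x2_1 x3_2) 3.
Proof.
case: tensP => tensL tensU; split.
  exists (tnth [tuple x1_2; x1_1; x1_1]), (tnth [tuple x2_1; x2_2; x2_1]),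
    (tnth [tuple x3_1; x3_1; x3_2]).
  by rewrite !big_ord_recl big_ord0 addr0 addrA.
move=> m; apply: contraPT; rewrite -ltnNge ltnS => m_le2.
case/(sum_of_pure_tensors_leq _ _ _ _ _ _ _ _ _ tensL m_le2).
move=> v1 [v2 [v3 betaE]].
have [f1 f1E] := free_pair_dual _ _ _ _ free1.
have [f2 f2E] := free_pair_dual _ _ _ _ free2.
have [f3 f3E] := free_pair_dual _ _ _ _ free3.
apply: (no_two_term_decomposition R (fun s i => f1 s (v1 i))
  (fun t i => f2 t (v2 i)) (fun u i => f3 u (v3 i))) => s t u.
(* [h] is the form [f1 s] ⊗ [f2 t] ⊗ [f3 u] on [T]; applied to both expressions of beta, it reads
   off the entry (s, t, u). *)
have [h [hE _]] := tensU _ _ (trilinear_form _ _ _ _ (f1 s) (f2 t) (f3 u)).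
transitivity (h (\sum_(i < 2) tens (v1 i) (v2 i) (v3 i))).
  by rewrite linear_sum; apply: eq_bigr => i _; rewrite hE.
rewrite -betaE !linearD !hE.
rewrite !(f1E, f2E, f3E).
by case: s t u {h hE} => [[|[|//]] ?] [[|[|//]] ?] [[|[|//]] ?] /=;
  rewrite ?mul0r ?mulr0 ?mulr1 ?addr0 ?add0r.
Qed.
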